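(* Let $(W,S)$ be a finite irreducible Coxeter system, let $\mathcal{P}$ be a (real) parameter tensor for $(W,S)$, and let $v=v_1\cdots v_N\in\mathcal{R}(w_\circ)$ be a reduced word of the longest element $w_\circ$, with abelian vector $\alpha_v$. Let $x_1,\dots,x_N$ be real numbers. If $x_i>0$ for all $i\in[N]$ and $x_j>x_i$ whenever $i<j$ and $v_i=v_j$, then \[ \operatorname{sign}\big(\det M(v,\mathcal{P})\big)=\sigma(v)\,\operatorname{sign}\Big(\sum_{\mathfrak{z}\in\mathfrak{Z}_{\alpha_v}}\det[\mathcal{P}]_{\mathfrak{z}}\;\mathsf{S}_{\Lambda_{\mathfrak{z}},\Omega_v}\Big), \] where the model matrix and the partial Schur functions are evaluated at $x_1,\dots,x_N$ and $\operatorname{sign}$ is the usual sign function $\mathbb{R}\to\{-1,0,1\}$.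
   Context: Setting. $(W,S)$ is a finite irreducible Coxeter system with $S=\{s_1<\dots<s_n\}$, $w_\circ$ is its longest element, $N$ is the length of $w_\circ$, $\mathcal{R}(w_\circ)$ is the set of reduced words of $w_\circ$ (words of length $N$ in $S$ representing $w_\circ$), and $\nu$ is the maximum number of occurrences of a letter in any word of $\mathcal{R}(w_\circ)$. Words. For $v=v_1\cdots v_N$, let $\{v\}_i:=\{j\in[N]:v_j=s_i\}$ and $c_i:=\#\{v\}_i$; the abelian vector is $\alpha_v=(c_1,\dots,c_n)$, and $\Omega_v:=(\{v\}_1,\dots,\{v\}_n)$. The $S$-sign is $\sigma(v)=(-1)^{\operatorname{inv}(v)}$, where $\operatorname{inv}(v)$ is the number of pairs $a<b$ with $v_b<v_a$. Parameter tensor and model matrix. A parameter tensor for $(W,S)$ is a real array $\mathcal{P}=(p^i{}_{s,k})$ with $(i,s,k)\in[N]\times S\times\{0,\dots,\nu-1\}$, regarded as an $N\times n\nu$ matrix with rows indexed by $i$ and columns indexed by pairs $(s,k)$ in lexicographic order. The model matrix $M(v,\mathcal{P})$ is the $N\times N$ matrix whose $(i,l)$ entry is $\sum_{k=0}^{\nu-1}p^i{}_{v_l,k}\,x_l^{k}$. Minors. $\mathfrak{Z}_{\alpha_v}$ is the collection of subsets $\mathfrak{z}\subseteq S\times\{0,\dots,\nu-1\}$ containing exactly $c_i$ elements with first coordinate $s_i$, for every $i\in[n]$. $[\mathcal{P}]_{\mathfrak{z}}$ is the $N\times N$ submatrix of $\mathcal{P}$ with columns $\mathfrak{z}$ in increasing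 lexicographic order. For $\mathfrak{z}\in\mathfrak{Z}_{\alpha_v}$, $\Lambda_{\mathfrak{z}}=(\lambda^{\mathfrak{z},1},\dots,\lambda^{\mathfrak{z},n})$, where $\lambda^{\mathfrak{z},i}$ is obtained by listing the second coordinates of the elements of $\mathfrak{z}$ with first coordinate $s_i$ in decreasing order and subtracting $c_i-j$ from the entry at position $j$, $j=1,\dots,c_i$. Schur functions. For a partition $\lambda=(\lambda_1\ge\dots\ge\lambda_d\ge0)$ and an ordered index set $J$ with $\#J=d$, $\mathsf{s}_{\lambda,J}$ is the polynomial \[\mathsf{s}_{\lambda,J}:=\frac{\det\big(x_j^{\,i-1+\lambda_{d-i+1}}\big)_{(i,j)\in[d]\times J}}{\det\big(x_j^{\,i-1}\big)_{(i,j)\in[d]\times J}}\] (quotient taken as polynomials in the variables $x_j$). For an ordered set partition $P=(p_1,\dots,p_n)$ of $[N]$ (empty parts allowed) and a sequence $\Lambda=(\lambda^1,\dots,\lambda^n)$ of partitions where $\lambda^i$ has $\#p_i$ parts (parts may be zero), the partial Schur function is $\mathsf{S}_{\Lambda,P}:=\prod_{i=1}^n\mathsf{s}_{\lambda^i,p_i}$. *)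

(* Defs.v *)
From HB Require Import structures.
From mathcomp Require Import all_boot all_order all_fingroup all_algebra.
From mathcomp Require Import classical_sets reals.
From mathcomp Require Import mpoly.

Set Implicit Arguments.
Unset Strict Implicit.
Unset Printing Implicit Defensive.

(** * Finite Coxeter systems *)

Section Coxeter.
Local Open Scope group_scope.

(* The set of generators is the range of the injective family [gen], ordered
   as ['I_n].  The last axiom says that W is presented by these generators and
   the relations (s t)^m(s,t) = 1, where m(s,t) is the order of s t: it is the
   universal property of the presented group, the test group H being an
   arbitrary, possibly infinite, group.  The case s = t gives s^2 = 1. *)
Record coxeterSystem (W : finGroupType) (n : nat) := CoxeterSystem {
  gen :> 'I_n -> W;
  gen_inj : injective gen;
  gen_order : forall i, #[gen i] = 2;
  gen_generate : <<[set gen i | i : 'I_n]>> = [set: W];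
  gen_presentation : forall (H : groupType) (f : 'I_n -> H),
    (forall i j, (f i * f j) ^+ #[gen i * gen j] = 1) ->
    exists phi : {multiplicative W -> H}, forall i, phi (gen i) = f i
}.

(* The Coxeter graph is nonempty and connected. *)
Definition irreducible_coxeter (W : finGroupType) (n : nat)
    (s : coxeterSystem W n) : Prop :=
  0 < n /\ forall i j, connect [rel a b | 2 < #[s a * s b]] i j.

Lemma exists_word (W : finGroupType) (n : nat) (s : coxeterSystem W n) (w : W) :
  exists m, [exists u : m.-tuple 'I_n, \prod_(i <- u) s i == w].
Proof.
have : w \in <<[set s i | i : 'I_n]>> by rewrite gen_generate inE.
case/gen_prodgP => m [c cS ->]; exists m.
have /fin_all_exists[f fE] : forall k, exists i, c k = s i.
  by move=> k; have /imsetP[i _ ->] := cS k; exists i.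
apply/existsP; exists [tuple f k | k < m].
by rewrite big_tuple; apply/eqP/eq_bigr => k _; rewrite tnth_mktuple fE.
Qed.

Definition cox_length (W : finGroupType) (n : nat)
    (s : coxeterSystem W n) (w : W) : nat := ex_minn (exists_word s w).

Definition is_longest (W : finGroupType) (n : nat)
    (s : coxeterSystem W n) (w0 : W) : Prop :=
  forall w, cox_length s w <= cox_length s w0.

Definition reduced_words (W : finGroupType) (n : nat)
    (s : coxeterSystem W n) (w : W) : {set (cox_length s w).-tuple 'I_n} :=
  [set u : (cox_length s w).-tuple 'I_n | \prod_(i <- u) s i == w].

End Coxeter.

(** * Words *)

Definition letter_set (n N : nat) (v : N.-tuple 'I_n) (i : 'I_n) : {set 'I_N} :=
  [set j | tnth v j == i].

Definition abelian_vector (n N : nat) (v : N.-tuple 'I_n) (i : 'I_n) : nat :=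
  #|letter_set v i|.

Definition inv_word (n N : nat) (v : N.-tuple 'I_n) : nat :=
  #|[set ab : 'I_N * 'I_N |
      (ab.1 < ab.2) && (tnth v ab.2 < tnth v ab.1)]|.

Definition S_sign (R : pzRingType) (n N : nat) (v : N.-tuple 'I_n) : R :=
  ((-1) ^+ inv_word v)%R.

Definition max_occ (W : finGroupType) (n : nat)
    (s : coxeterSystem W n) (w0 : W) : nat :=
  \max_(u in reduced_words s w0) \max_(i < n) abelian_vector u i.

Local Open Scope ring_scope.

(** * Parameter tensors and model matrices *)

Definition param_tensor (R : Type) (N n nu : nat) : Type :=
  'I_N -> 'I_n -> 'I_nu -> R.

Definition model_matrix (R : pzRingType) (N n nu : nat)
    (v : N.-tuple 'I_n) (P : param_tensor R N n nu) (x : 'I_N -> R) : 'M[R]_N :=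
  \matrix_(i, l) \sum_(k < nu) P i (tnth v l) k * x l ^+ k.

Definition minor_sets (n nu : nat) (alpha : 'I_n -> nat) :
    {set {set 'I_n * 'I_nu}} :=
  [set z : {set 'I_n * 'I_nu} |
    [forall i, #|[set sk in z | sk.1 == i]| == alpha i]].

Definition lex_sorted (n nu : nat) (z : {set 'I_n * 'I_nu}) :
    seq ('I_n * 'I_nu) :=
  sort (<=%O : rel ('I_n *l 'I_nu)) (enum z).

(* The default value 0 of [nth] is never used when #|z| = N. *)
Definition tensor_minor (R : pzRingType) (N n nu : nat)
    (P : param_tensor R N n nu) (z : {set 'I_n * 'I_nu}) : 'M[R]_N :=
  \matrix_(i, l) nth 0 [seq P i sk.1 sk.2 | sk <- lex_sorted z] l.

(* Position j is counted from 0, so that c - j becomes c - j.+1.  For z in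
   [minor_sets alpha] the subtraction is never truncated. *)
Definition minor_partition (n nu : nat) (alpha : 'I_n -> nat)
    (z : {set 'I_n * 'I_nu}) (i : 'I_n) : seq nat :=
  let ks := sort geq [seq nat_of_ord sk.2 | sk <- enum z & sk.1 == i] in
  mkseq (fun j => nth 0 ks j - (alpha i - j.+1))%N (alpha i).

(** * Schur functions *)

(* Exact quotient; {mpoly R[N]} is an integral domain, so the value is the only
   q such that q * b = a as soon as b != 0 and b divides a. *)
Definition mpoly_quot (R : idomainType) (N : nat) (a b : {mpoly R[N]}) :
    {mpoly R[N]} :=
  xget 0 [set q : {mpoly R[N]} | q * b = a]%classic.

(* [enum_val] lists J increasingly.  With 0-based i the exponent i-1+lam_(d-i+1)
   becomes i + nth 0 lam (d - i.+1). *)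
Definition schur (R : idomainType) (N : nat) (lam : seq nat) (J : {set 'I_N}) :
    {mpoly R[N]} :=
  let d := #|J| in
  mpoly_quot
    (\det (\matrix_(i < d, j < d)
        ('X_(enum_val j) : {mpoly R[N]}) ^+ (i + nth 0%N lam (d - i.+1))))
    (\det (\matrix_(i < d, j < d) ('X_(enum_val j) : {mpoly R[N]}) ^+ i)).

Definition partial_schur (R : idomainType) (N n : nat)
    (Lam : 'I_n -> seq nat) (P : 'I_n -> {set 'I_N}) : {mpoly R[N]} :=
  \prod_(i < n) schur R (Lam i) (P i).

(* Main.v *)
(* Cauchy-Binet expands the determinant of the model matrix, a product of P
   with the matrix X of entries [s = v_l] x_l^k, over the column sets z.  The
   minor of X at z vanishes unless z has as many keys of each letter as v.
   Otherwise, sorting v makes it block diagonal, at the cost of the sign of the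
   sorting permutation, which is sigma(v); its blocks are generalized
   Vandermonde matrices, whose determinants are Schur functions times
   Vandermonde determinants.  The latter do not depend on z and are positive
   because x increases along the positions of each letter. *)

Require Import Defs.
From mathcomp Require Import all_boot all_order all_fingroup all_algebra.
From mathcomp Require Import reals.
From mathcomp Require Import mpoly.
Set Implicit Arguments.
Unset Strict Implicit.
Unset Printing Implicit Defensive.
Import GRing.Theory Num.Theory.
Local Open Scope ring_scope.

(** * The Cauchy-Binet formula *)

(** Multilinearity in the columns: [f j] records which term of the sum is chosen in column [j]. *)
Lemma det_mx_sum (R : comPzRingType) (T : finType) N
    (A : 'I_N -> T -> R) (B : T -> 'I_N -> R) :
  \det (\matrix_(i, j) \sum_t A i t * B t j) =
  \sum_(f : {ffun 'I_N -> T})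
     \det (\matrix_(i, j) A i (f j)) * \prod_j B (f j) j.
Proof.
rewrite -det_tr [LHS]/determinant.
under eq_bigr => s _.
  under eq_bigr => j _ do rewrite !mxE.
  rewrite bigA_distr_bigA mulr_sumr.
  under eq_bigr => f _ do rewrite big_split mulrA.
  over.
rewrite exchange_big; apply: eq_bigr => f _.
rewrite -mulr_suml -[in RHS]det_tr; congr (_ * _).
by apply: eq_bigr => s _; under [in RHS]eq_bigr => j _ do rewrite !mxE.
Qed.

(** Replaces the lookups [nth x0 (map F r)] in minors by an injective enumeration [u] of [z], free
    of default values. *)
Lemma nth_perm_enum (T : finType) N (z : {set T}) (r : seq T) :
  #|z| = N -> perm_eq r (enum z) ->
  exists u : 'I_N -> T, [/\ injective u, forall t, t \in z -> exists l, u l = t,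
    forall l, u l \in z &
    forall (U : Type) (x0 : U) (F : T -> U) (l : 'I_N), nth x0 (map F r) l = F (u l)].
Proof.
move=> zN rz; have rN : size r = N by rewrite (perm_size rz) -cardE.
have rU : uniq r by rewrite (perm_uniq rz) enum_uniq.
have zr t : (t \in z) = (t \in r) by rewrite (perm_mem rz) mem_enum.
exists (fun l => tnth (tcast rN (in_tuple r)) l).
have uE x0 l : tnth (tcast rN (in_tuple r)) l = nth x0 r l.
  by rewrite (tnth_nth x0) val_tcast.
split.
- move=> a b; set c := tnth _ a; have := erefl c; rewrite {1}/c (uE c) => <-.
  rewrite (uE c) => /eqP; rewrite nth_uniq ?rN // => /eqP; exact: val_inj.
- move=> t; rewrite zr => tr.
  have lt_i : (index t r < N)%N by rewrite -rN index_mem.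
  by exists (Ordinal lt_i); rewrite (uE t) nth_index.
- move=> l; have := mem_tnth l (tcast rN (in_tuple r)).
  by rewrite zr memtE val_tcast.
- move=> U x0 F l; rewrite (nth_map (tnth (tcast rN (in_tuple r)) l)) ?rN //.
  by rewrite -uE.
Qed.

(** A non-injective [f] repeats a column and contributes nothing; the injective ones are grouped by
    their image [z]. Those with image [z] are [u] composed with a permutation [s], and the sign that
    [s] produces in the minor of [A] turns the sum over [s] into the minor of [B]. Any order [e z]
    will do, since reordering changes the sign of both minors. *)
Lemma Cauchy_Binet (R : comPzRingType) (T : finType) N
    (A : 'I_N -> T -> R) (B : T -> 'I_N -> R) (e : {set T} -> seq T)
    (eP : forall z, perm_eq (e z) (enum z)) :
  \det (\matrix_(i, j) \sum_t A i t * B t j) =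
  \sum_(z : {set T} | #|z| == N)
     \det (\matrix_(i < N, l < N) nth 0 [seq A i t | t <- e z] l) *
     \det (\matrix_(l < N, j < N) nth 0 [seq B t j | t <- e z] l).
Proof.
rewrite det_mx_sum (bigID (fun f : {ffun _ -> _} => injectiveb f)) /=.
rewrite [X in _ + X]big1 ?addr0; last first.
  move=> f /injectivePn[a [b ab fab]].
  by rewrite -det_tr (determinant_alternate ab) ?mul0r // => i; rewrite !mxE fab.
rewrite (partition_big (fun f : {ffun 'I_N -> T} => [set f l | l : 'I_N])
           (fun z : {set T} => #|z| == N)) /=; last first.
  by move=> f /injectiveP finj; rewrite card_imset // card_ord.
apply: eq_bigr => z /eqP zN.
have [u [u_inj u_surj uz uE]] := nth_perm_enum zN (eP z).
have -> : \det (\matrix_(l < N, j < N) nth 0 [seq B t j | t <- e z] l) =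
    \sum_(s : 'S_N) (-1) ^+ s * \prod_j B (u (s j)) j.
  rewrite -det_tr; apply: eq_bigr => s _; congr (_ * _).
  by apply: eq_bigr => j _; rewrite !mxE uE.
rewrite mulr_sumr.
rewrite (reindex (fun s : 'S_N => [ffun j => u (s j)])) /=; last first.
  (* [w] is a left inverse of [u]; its second argument is the default index, as ['I_N] may be
     empty. *)
  have [w uK] : exists w : T -> 'I_N -> 'I_N, forall l i, w (u l) i = l.
    exists (fun t i => odflt i [pick l | u l == t]) => l i.
    by case: pickP => [k /eqP /u_inj //|/(_ l)]; rewrite eqxx.
  have f_inj (f : {ffun 'I_N -> T}) : injectiveb f ->
      [set f l | l : 'I_N] == z -> injective (fun j => w (f j) j).
    move=> /injectiveP f_inj /eqP fz a b.
    have [|k ka] := u_surj (f a); first by rewrite -fz imset_f.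
    have [|k' kb] := u_surj (f b); first by rewrite -fz imset_f.
    by rewrite -ka -kb !uK => kk'; apply: f_inj; rewrite -ka -kb kk'.
  (* The inverse sends [f] to the permutation sending [j] to the index of [f j] in [z]; the value
     [1%g] is never reached on injective [f] with image [z]. *)
  exists (fun f : {ffun 'I_N -> T} =>
    if (insub [ffun j => w (f j) j] : option 'S_N) is Some s then s else 1%g) => [s _|f].
    have -> : [ffun j => w ([ffun j => u (s j)] j) j] = pval s.
      by apply/ffunP=> j; rewrite !ffunE uK; rewrite pvalE.
    by rewrite valK.
  rewrite inE => /andP[fi fz].
  case: insubP => [s _ sE|]; last first.
    by case/injectiveP => a b; rewrite !ffunE => /(f_inj f fi fz).
  apply/ffunP=> j; rewrite ffunE.
  have -> : s j = w (f j) j.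
    by rewrite -[w _ _](ffunE (fun j => w (f j) j)) -sE pvalE.
  have [|k ka] := u_surj (f j); first by rewrite -(eqP fz) imset_f.
  by rewrite -ka uK.
apply: eq_big => [s|s _].
  apply/andP; split.
    by apply/injectiveP=> a b; rewrite !ffunE => /u_inj /perm_inj.
  rewrite eqEcard zN card_imset ?card_ord ?leqnn ?andbT; last first.
    by move=> a b; rewrite !ffunE => /u_inj /perm_inj.
  by apply/subsetP=> _ /imsetP[l _ ->]; rewrite ffunE.
under eq_bigr do rewrite ffunE.
rewrite mulrA; congr (_ * _).
(* The sign of [s] becomes the determinant of a permutation matrix that reorders the columns of the
   minor of [A]. *)
rewrite -(det_perm _ s) -det_tr -[in RHS]det_tr mulrC -det_mulmx -row_permE.
by congr (\det _); apply/matrixP=> i j; rewrite !mxE ffunE uE.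
Qed.

(** * Permutation signs and block-diagonal determinants *)

(** The Vandermonde determinant at the values of [s] is computed twice: permuting its columns gives
    the sign of [s], and its product formula has one negative factor for each inversion. Signs of
    numbers need an order, hence the detour through [int]. *)
Lemma sign_perm_inv (R : pzRingType) N (s : 'S_N) :
  (-1) ^+ s = (-1) ^+ #|[set ab : 'I_N * 'I_N |
    (ab.1 < ab.2)%N && (s ab.2 < s ab.1)%N]| :> R.
Proof.
suff E : (-1) ^+ s = (-1) ^+ #|[set ab : 'I_N * 'I_N |
    (ab.1 < ab.2)%N && (s ab.2 < s ab.1)%N]| :> int.
  have := congr1 (fun m : int => m%:~R : R) E.
  by rewrite !rmorphXn !rmorphN1.
set I := [set _ | _].
pose V (t : 'S_N) := \det (Vandermonde N (\row_j (t j)%:Z)).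
have VE t : V t = \prod_(ab : 'I_N * 'I_N | (ab.1 < ab.2)%N)
    ((t ab.2)%:Z - (t ab.1)%:Z).
  rewrite /V det_Vandermonde pair_big_dep /=.
  by apply: eq_bigr => ab _; rewrite !mxE.
have V1 : Num.sg (V 1%g) = 1.
  apply: gtr0_sg; rewrite VE; apply: prodr_gt0 => ab lt_ab.
  by rewrite !perm1 subr_gt0 ltz_nat.
have Vs : V s = V 1%g * (-1) ^+ s.
  rewrite /V -odd_permV -det_perm -det_mulmx -col_permE.
  by congr (\det _); apply/matrixP=> i j; rewrite !mxE perm1.
have <- : Num.sg (V s) = (-1) ^+ s.
  by rewrite Vs sgrM V1 mul1r sgrX sgrN1.
rewrite VE (big_morph _ (@sgrM _) (sgr1 _)) (bigID [pred ab | ab \in I]) /=.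
rewrite [X in _ * X]big1 ?mulr1 => [|[a b] /=]; last first.
  rewrite inE /= => /andP[ab]; rewrite ab /= -leqNgt leq_eqVlt => /orP[/eqP E|lt_s].
    by move: ab; rewrite (perm_inj (val_inj E)) ltnn.
  by rewrite gtr0_sg // subr_gt0 ltz_nat.
rewrite (eq_bigl (fun ab => ab \in I)) => [|ab]; last by rewrite inE andbA andbb.
rewrite -prodr_const; apply: eq_bigr => ab.
by rewrite inE => /andP[_ lt_s]; rewrite ltr0_sg // subr_lt0 ltz_nat.
Qed.

(** Rows and columns are relabelled by the same permutation, so its sign occurs squared. *)
Lemma det_mxsub_image (R : comPzRingType) N m m' (A : 'M[R]_N)
    (g : 'I_m -> 'I_N) (g' : 'I_m' -> 'I_N) :
  injective g -> injective g' -> codom g =i codom g' ->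
  \det (mxsub g g A) = \det (mxsub g' g' A).
Proof.
move=> g_inj g'_inj gg'.
have mm' : m = m'.
  by rewrite -(card_ord m) -(card_ord m') -(card_codom g_inj)
             -(card_codom g'_inj) (eq_card gg').
case: _ / mm' in g' g'_inj gg' *.
have /fin_all_exists[h hE] : forall a, exists b, g a = g' b.
  by move=> a; apply/codomP; rewrite -gg' codom_f.
have h_inj : injective h by move=> a b hab; apply: g_inj; rewrite !hE hab.
pose s := perm h_inj.
have -> : mxsub g g A = row_perm s (col_perm s (mxsub g' g' A)).
  by apply/matrixP=> i j; rewrite !mxE !permE -!hE.
rewrite row_permE col_permE !det_mulmx !det_perm odd_permV mulrCA.
by rewrite -expr2 sqrr_sign mulr1.
Qed.

(** Listing [I] before [J] makes the principal submatrix block lower triangular. *)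
Lemma det_mxsub_setU (R : comPzRingType) N (A : 'M[R]_N) (I J : {set 'I_N}) :
  [disjoint I & J] -> (forall i j, i \in I -> j \in J -> A i j = 0) ->
  \det (mxsub (fun a : 'I_#|I :|: J| => enum_val a) (fun a => enum_val a) A) =
  \det (mxsub (fun a : 'I_#|I| => enum_val a) (fun a => enum_val a) A) *
  \det (mxsub (fun a : 'I_#|J| => enum_val a) (fun a => enum_val a) A).
Proof.
move=> IJ A0.
pose g (a : 'I_(#|I| + #|J|)) : 'I_N :=
  match split a with inl b => enum_val b | inr b => enum_val b end.
have IJF b c : enum_val (A := I) b = enum_val (A := J) c -> False.
  by move=> bc; have := disjointFr IJ (enum_valP b); rewrite bc enum_valP.
rewrite (@det_mxsub_image _ _ _ _ A _ g).
- rewrite -(det_lblock _ (mxsub (fun a : 'I_#|J| => enum_val a)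
                                (fun a : 'I_#|I| => enum_val a) A)).
  congr (\det _); apply/matrixP=> i j; rewrite !mxE /g.
  case: (split i) => a; rewrite mxE; case: (split j) => b; rewrite !mxE //.
  by rewrite A0 ?enum_valP.
- exact: enum_val_inj.
- move=> a b; rewrite /g -{2}(splitK a) -{2}(splitK b).
  case: (split a) (split b) => [a'|a'] [b'|b'].
  + by move/enum_val_inj->.
  + by move/IJF.
  + by move/esym/IJF.
  + by move/enum_val_inj->.
- move=> i; apply/codomP/codomP => [[a ->]|[a ->]].
    have := enum_valP a; rewrite inE => /orP[aI|aJ].
      exists (unsplit (inl (enum_rank_in aI (enum_val a)))).
      by rewrite /g unsplitK enum_rankK_in.
    exists (unsplit (inr (enum_rank_in aJ (enum_val a)))).
    by rewrite /g unsplitK enum_rankK_in.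
  have gP : g a \in I :|: J.
    by rewrite /g inE; case: (split a) => b; rewrite enum_valP ?orbT.
  by exists (enum_rank_in gP (g a)); rewrite enum_rankK_in.
Qed.

(** The classes of [c] need not be intervals: principal submatrices may be regrouped without a sign.
    The classes are split off one at a time, by induction on a list of colours. *)
Lemma det_block_diag (R : comPzRingType) N n (A : 'M[R]_N) (c : 'I_N -> 'I_n) :
  (forall i j, c i != c j -> A i j = 0) ->
  \det A = \prod_(k < n) \det (mxsub
    (fun a : 'I_#|[set j | c j == k]| => enum_val a) (fun a => enum_val a) A).
Proof.
move=> A0; have step (r : seq 'I_n) : uniq r ->
    \det (mxsub (fun a : 'I_#|[set j | c j \in r]| => enum_val a)
                (fun a => enum_val a) A) =
    \prod_(k <- r) \det (mxsub
    (fun a : 'I_#|[set j | c j == k]| => enum_val a) (fun a => enum_val a) A).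
  elim: r => [_|k r IHr /= /andP[kr /IHr IHr_eq]].
    have E : [set j | c j \in [::]] = set0 by apply/setP=> j; rewrite !inE.
    (* The enumeration is abstracted so that its dimension can be rewritten to 0, where the
       determinant is 1. *)
    rewrite big_nil E; move: (cards0 'I_N); set J := set0 => J0.
    move: (fun a : 'I_#|J| => enum_val a); rewrite J0 => h.
    by rewrite det_mx00.
  rewrite big_cons -IHr_eq -det_mxsub_setU.
  - have -> // : [set j | c j \in k :: r] =
      [set j | c j == k] :|: [set j | c j \in r].
    by apply/setP=> j; rewrite !inE.
  - rewrite disjoints_subset; apply/subsetP=> j; rewrite !inE => /eqP->.
    by [].
  - move=> i j; rewrite !inE => /eqP ci cj; apply: A0.
    by apply: contraNneq kr; rewrite -ci => ->.
rewrite -(step _ (index_enum_uniq _)).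
have -> : A = mxsub id id A by apply/matrixP=> i j; rewrite !mxE.
rewrite (@det_mxsub_image _ _ _ _ A id (fun a =>
  enum_val (A := [set j | c j \in index_enum 'I_n]) a)) //.
- by congr (\det _); apply/matrixP=> i j; rewrite !mxE.
- exact: enum_val_inj.
- move=> i; have iP : i \in [set j | c j \in index_enum 'I_n].
    by rewrite inE mem_index_enum.
  rewrite (codom_f id i).
  apply/esym/codomP; exists (enum_rank_in iP i); by rewrite enum_rankK_in.
Qed.

(** * Alternants and Schur functions *)

(* Reducing each 'X^k modulo [\prod_j ('X - y_j)] writes the alternant as a
   matrix of remainders times the Vandermonde matrix. *)
Lemma Vandermonde_dvd_alternant (R : comNzRingType) d (y : 'I_d -> R)
    (k : 'I_d -> nat) :
  exists q, q * \det (\matrix_(i < d, j < d) y j ^+ i) =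
            \det (\matrix_(i < d, j < d) y j ^+ k i).
Proof.
pose D := \prod_(j < d) ('X - (y j)%:P).
have Dmon : D \is monic by apply: monic_prod => j _; exact: monicXsubC.
pose r i := Pdiv.Ring.rmodp 'X^(k i) D.
exists (\det (\matrix_(i < d, m < d) (r i)`_m)).
rewrite -det_mulmx; congr (\det _); apply/matrixP=> i j; rewrite !mxE.
have sz : (size (r i) <= d)%N.
  rewrite -ltnS (_ : d.+1 = size D) ?Pdiv.Ring.ltn_rmodpN0 ?monic_neq0 //.
  by rewrite size_prod_XsubC /index_enum -enumT size_enum_ord.
under eq_bigr do rewrite !mxE.
rewrite -(horner_coef_wide _ sz).
have /(congr1 (horner^~ (y j))) := Pdiv.RingMonic.rdivp_eq Dmon 'X^(k i).
rewrite !hornerE (_ : D.[y j] = 0) ?mulr0 ?add0r => [->//|].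
by rewrite /D horner_prod (bigD1 j) //= !hornerE subrr mul0r.
Qed.

(** Divisibility of the alternant by the Vandermonde determinant, applied to the indeterminates,
    shows that [xget] returns a genuine quotient. Stating the result as a product avoids dividing
    after evaluation, where the denominator may vanish. *)
Lemma schur_eval (R : idomainType) N (lam : seq nat) (J : {set 'I_N})
    (x : 'I_N -> R) :
  (schur R lam J).@[x] * \det (\matrix_(i < #|J|, j < #|J|) x (enum_val j) ^+ i)
  = \det (\matrix_(i < #|J|, j < #|J|)
            x (enum_val j) ^+ (i + nth 0%N lam (#|J| - i.+1))).
Proof.
have evE (k : 'I_#|J| -> nat) :
    \det (\matrix_(i < #|J|, j < #|J|) x (enum_val j) ^+ k i) =
    (\det (\matrix_(i < #|J|, j < #|J|)
       ('X_(enum_val j) : {mpoly R[N]}) ^+ k i)).@[x].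
  rewrite -det_map_mx; congr (\det _); apply/matrixP=> i j.
  by rewrite !mxE rmorphXn /= mevalXU.
rewrite (evE (fun i => i)) (evE (fun i => i + nth 0%N lam (#|J| - i.+1))%N).
rewrite -mevalM; congr (meval _ _); rewrite /schur /mpoly_quot.
exact: (classical_sets.xgetPex 0 (Vandermonde_dvd_alternant _ _)).
Qed.

(** * Sorted keys, partitions and the sorting permutation *)

(** The strict lexicographic order, spelled out with comparisons of naturals so that case analysis
    on them applies directly. *)
Definition lex_lt (n m : nat) : rel ('I_n * 'I_m) :=
  fun a b => (a.1 < b.1)%N || (a.1 == b.1) && (a.2 < b.2)%N.

Lemma lex_lt_trans n m : transitive (@lex_lt n m).
Proof.
move=> [b1 b2] [a1 a2] [c1 c2]; rewrite /lex_lt /= -!val_eqE /=.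
case: (ltngtP a1 b1) => //= ab; case: (ltngtP b1 c1) => //= bc.
- by rewrite (ltn_trans ab bc).
- by rewrite -bc ab.
- by rewrite ab bc.
- by rewrite ab bc ltnn eqxx; apply: ltn_trans.
Qed.

Lemma lex_lt_irr n m : irreflexive (@lex_lt n m).
Proof. by move=> a; rewrite /lex_lt !ltnn andbF. Qed.

Lemma perm_lex_sorted n nu (z : {set 'I_n * 'I_nu}) :
  perm_eq (lex_sorted z) (enum z).
Proof. by rewrite perm_sort. Qed.

Lemma lex_sortedP n nu (z : {set 'I_n * 'I_nu}) :
  sorted (@lex_lt n nu) (lex_sorted z).
Proof.
have sz : sorted (<=%O : rel ('I_n *l 'I_nu)) (lex_sorted z).
  exact/sort_sorted/Order.TotalTheory.le_total.
have : uniq (lex_sorted z) by rewrite (perm_uniq (perm_lex_sorted z)) enum_uniq.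
move=> uz; have := @Order.POrderTheory.lt_sorted_uniq_le _ ('I_n *l 'I_nu)%type (lex_sorted z).
rewrite uz sz => slt.
apply: sub_sorted slt => -[a1 a2] [b1 b2].
rewrite Order.ProdLexiOrder.ltEprodlexi /lex_lt /= -val_eqE.
change ((a1 <= b1)%N && ((b1 <= a1)%N ==> (a2 < b2)%N) ->
  (a1 < b1)%N || (val a1 == val b1) && (a2 < b2)%N).
by case: (ltngtP (val a1) (val b1)).
Qed.

(** Shows that the subtraction in [minor_partition] is not truncated. *)
Lemma sorted_ltn_nth_ge (s : seq nat) a :
  sorted ltn s -> (a < size s)%N -> (a <= nth 0 s a)%N.
Proof.
move=> s_lt; elim: a => [//|a IHa] lt_a.
apply: leq_ltn_trans (IHa (ltnW lt_a)) _.
by apply: (sorted_ltn_nth ltn_trans 0%N s_lt) => //; rewrite inE ltnW.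
Qed.

Lemma letter_set_index n N (v : N.-tuple 'I_n) (l : 'I_N) :
  (index l (enum (letter_set v (tnth v l))) < #|letter_set v (tnth v l)|)%N.
Proof. by rewrite cardE index_mem mem_enum inE. Qed.

Lemma sorted_enum_ord N (A : {pred 'I_N}) :
  sorted (fun a b : 'I_N => (a < b)%N) (enum A).
Proof.
rewrite /enum_mem; apply: sorted_filter => [b a c|]; first exact: ltn_trans.
by have := iota_ltn_sorted 0 N; rewrite -val_enum_ord sorted_map enumT.
Qed.

Lemma ltn_enum_val N (A : {pred 'I_N}) (a b : 'I_#|A|) :
  (a < b)%N -> (enum_val a < enum_val b)%N.
Proof.
move=> ab; have i0 := enum_val a.
rewrite (enum_val_nth i0 a) (enum_val_nth i0 b).
apply: (sorted_ltn_nth (leT := fun i j : 'I_N => (i < j)%N)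
  _ _ (sorted_enum_ord A)) => //.
- by move=> ? ? ?; apply: ltn_trans.
- by rewrite inE -cardE.
- by rewrite inE -cardE.
Qed.

Lemma size_letter_keys n N nu (v : N.-tuple 'I_n) (z : {set 'I_n * 'I_nu}) i :
  z \in minor_sets nu (abelian_vector v) ->
  size [seq sk <- lex_sorted z | sk.1 == i] = #|letter_set v i|.
Proof.
rewrite inE => /forallP/(_ i)/eqP; rewrite /abelian_vector => <-.
rewrite size_filter (seq.permP (perm_lex_sorted z)) -size_filter cardE.
rewrite /enum_mem -filter_predI; congr (size _).
by apply: eq_filter => sk; rewrite !inE andbC.
Qed.

Lemma card_minor_set n N nu (v : N.-tuple 'I_n) (z : {set 'I_n * 'I_nu}) :
  z \in minor_sets nu (abelian_vector v) -> #|z| = N.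
Proof.
rewrite inE => /forallP zP.
rewrite -sum1_card (partition_big fst predT) //=.
transitivity (\sum_(i < n) #|letter_set v i|)%N.
  apply: eq_bigr => i _; have := eqP (zP i); rewrite /abelian_vector => <-; rewrite -sum1_card.
  by apply: eq_bigl => sk; rewrite inE.
rewrite -[RHS]card_ord -sum1_card (partition_big (tnth v) predT) //=.
by apply: eq_bigr => i _; rewrite -sum1_card; apply: eq_bigl => l; rewrite inE.
Qed.

(* Position [j] of the partition counts from the largest key, position [a] of
   the sorted keys from the smallest. *)
Lemma nth_minor_partition n N nu (v : N.-tuple 'I_n) (z : {set 'I_n * 'I_nu})
    i (a : 'I_#|letter_set v i|) sk0 :
  z \in minor_sets nu (abelian_vector v) ->
  (a + nth 0 (minor_partition (abelian_vector v) z i)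
         (#|letter_set v i| - a.+1))%N =
  (nth sk0 [seq sk <- lex_sorted z | sk.1 == i] a).2 :> nat.
Proof.
move=> zP; have szP := size_letter_keys i zP.
set r := [seq sk <- _ | _] in szP *; set c := #|letter_set v i| in a szP *.
pose t := [seq nat_of_ord sk.2 | sk <- r].
(* Among keys with the same letter, the lexicographic order compares second coordinates. *)
have t_lt : sorted ltn t.
  rewrite sorted_map.
  have := sorted_filter (@lex_lt_trans n nu) (fun sk => sk.1 == i) (lex_sortedP z).
  rewrite -/r; apply: sub_in_sorted (_ : all (fun sk => sk.1 == i) r).
    move=> x y /eqP xi /eqP yi; rewrite /lex_lt xi yi ltnn eqxx //.
  exact: filter_all.
have sz_t : size t = c by rewrite size_map.
rewrite /minor_partition.
set ks := sort _ _.
have -> : ks = rev t.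
  apply: (@sorted_eq _ geq).
  - by move=> y x w /= xy yw; apply: leq_trans yw xy.
  - by move=> x y /= /andP[xy yx]; apply/eqP; rewrite eqn_leq xy yx.
  - by apply: sort_sorted => x y; apply: leq_total.
  - rewrite rev_sorted; apply: sub_sorted t_lt => x y; exact: ltnW.
  - rewrite perm_sort perm_sym perm_rev perm_map //.
    by apply: perm_filter; apply: perm_lex_sorted.
have lt_c : (c - a.+1 < c)%N by rewrite ltn_subrL /= (leq_ltn_trans _ (ltn_ord a)).
(* Position [c - a.+1] of the reversed list is position [a] of [t], and the amount subtracted there
   is [a] as well. *)
rewrite nth_mkseq // nth_rev ?sz_t // -/c /abelian_vector.
rewrite -/c subnSK // subKn; last by rewrite ltnW.
rewrite subnKC ?sorted_ltn_nth_ge ?sz_t //.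
by rewrite (nth_map sk0) ?szP.
Qed.

(** If [l] is the k-th position of its letter in [v], then [h l] is the k-th key of that letter in
    [z]. The permutation [p] sends [l] to the place of [h l] among all sorted keys; it is the stable
    sort of [v], the same for every [z]. *)
Lemma minor_set_word n N nu (v : N.-tuple 'I_n) (z : {set 'I_n * 'I_nu}) :
  z \in minor_sets nu (abelian_vector v) ->
  exists (h : 'I_N -> 'I_n * 'I_nu) (p : 'S_N), [/\
    forall l, (h l).1 = tnth v l,
    forall (U : Type) (x0 : U) (F : 'I_n * 'I_nu -> U) (l : 'I_N),
      nth x0 [seq F sk | sk <- lex_sorted z] (p l) = F (h l),
    forall l m : 'I_N, (p l < p m)%N =
      (tnth v l < tnth v m)%N || (tnth v l == tnth v m) && (l < m)%N &
    forall i (a : 'I_#|letter_set v i|),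
      (h (enum_val a)).2 = (a + nth 0 (minor_partition (abelian_vector v) z i)
        (#|letter_set v i| - a.+1))%N :> nat].
Proof.
move=> zP; set L := lex_sorted z.
pose key i := [seq sk <- L | sk.1 == i].
pose idx l := index l (enum (letter_set v (tnth v l))).
have idxP l : (idx l < size (key (tnth v l)))%N.
  by rewrite (size_letter_keys _ zP) letter_set_index.
(* The bound [idxP] rules out an empty list of keys, so the chosen key does not depend on the
   default [sk0]. *)
have /fin_all_exists[h hE] : forall l, exists sk, forall sk0,
    sk = nth sk0 (key (tnth v l)) (idx l).
  move=> l; case E: (key (tnth v l)) (idxP l) => [//|sk r] lt_l.
  by exists (nth sk (sk :: r) (idx l)) => sk0; apply: set_nth_default.
have h_key l : h l \in key (tnth v l) by rewrite (hE l (h l)) mem_nth.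
have hL l : h l \in L by have := h_key l; rewrite mem_filter => /andP[].
have h1 l : (h l).1 = tnth v l.
  by have := h_key l; rewrite mem_filter => /andP[/eqP].
pose lt_v (l m : 'I_N) :=
  (tnth v l < tnth v m)%N || (tnth v l == tnth v m) && (l < m)%N.
have lt_h l m : lt_v l m -> lex_lt (h l) (h m).
  case/orP => [lt_lm|/andP[/eqP lm lt_lm]]; first by rewrite /lex_lt !h1 lt_lm.
  have lt_idx : (idx l < idx m)%N.
    rewrite /idx lm; set r := enum _.
    have [lr mr] : l \in r /\ m \in r by rewrite !mem_enum !inE lm eqxx.
    rewrite ltnNge leq_eqVlt; apply/norP; split.
      apply/eqP => /(congr1 (nth l r)); rewrite !nth_index // => ml.
      by rewrite ml ltnn in lt_lm.
    have tr : transitive (fun a b : 'I_N => (a < b)%N).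
      by move=> ? ? ?; apply: ltn_trans.
    apply/negP => /(sorted_ltn_index tr (sorted_enum_ord _) _ _ mr lr).
    by rewrite ltnNge ltnW.
  rewrite (hE l (h l)) (hE m (h l)) lm.
  apply: (sorted_ltn_nth (@lex_lt_trans n nu)) => //.
  - exact/(sorted_filter (@lex_lt_trans n nu))/lex_sortedP.
  - by rewrite inE -lm.
  - by rewrite inE.
have sL : size L = N.
  by rewrite (perm_size (perm_lex_sorted z)) -cardE (card_minor_set zP).
have p_lt l : (index (h l) L < N)%N by rewrite -sL index_mem.
pose q l := Ordinal (p_lt l).
have lt_q l m : lt_v l m -> (q l < q m)%N.
  move/lt_h => lt_lm; rewrite ltn_neqAle; apply/andP; split.
    apply/eqP => /= /(congr1 (nth (h l) L)); rewrite !nth_index // => hlm.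
    by rewrite hlm lex_lt_irr in lt_lm.
  rewrite leqNgt; apply/negP => /=.
  move=> /(sorted_ltn_index (@lex_lt_trans n nu) (lex_sortedP z)
    _ _ (hL m) (hL l)) /lex_lt_trans/(_ lt_lm).
  by rewrite lex_lt_irr.
(* As [lt_v] compares any two distinct positions, the map [q], being monotone for it, is injective
   and reflects it. *)
have lt_total l m : l != m -> lt_v l m || lt_v m l.
  rewrite /lt_v -!val_eqE /=; case: ltngtP => //= _.
  by case: ltngtP.
have q_inj : injective q.
  move=> l m qlm; apply: contraTeq isT => /lt_total/orP[] /lt_q;
  by rewrite qlm ltnn.
exists h, (perm q_inj); split => //.
- move=> U x0 F l; rewrite permE (nth_map (h l)) /=; first by rewrite nth_index.
  by rewrite sL.
- move=> l m; rewrite !permE -/(lt_v l m); apply/idP/idP; last exact: lt_q.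
  have [->|/lt_total/orP[//|/lt_q]] := eqVneq l m; first by rewrite ltnn.
  by move=> ml /(ltn_trans ml); rewrite ltnn.
- move=> i a; have vi : tnth v (enum_val a) = i.
    by have := enum_valP a; rewrite inE => /eqP.
  rewrite (nth_minor_partition _ (h (enum_val a)) zP).
  have idx_a : index (enum_val a) (enum (letter_set v i)) = a.
    by rewrite (enum_val_nth (enum_val a)) index_uniq ?enum_uniq -?cardE.
  by rewrite [in LHS](hE _ (h (enum_val a))) vi /idx vi idx_a.
Qed.

(** * Minors of the monomial matrix and the sign of the determinant *)

(** After permuting the rows by [p], row [a] carries the key [h a], whose letter is that of position
    [a]. The matrix is then block diagonal along the letters, with one alternant per letter. *)
Lemma det_minor_set (R : idomainType) n N nu (v : N.-tuple 'I_n)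
    (z : {set 'I_n * 'I_nu}) (x : 'I_N -> R) :
  z \in minor_sets nu (abelian_vector v) ->
  \det (\matrix_(l < N, j < N) nth 0
     [seq (t.1 == tnth v j)%:R * x j ^+ t.2 | t : 'I_n * 'I_nu <- lex_sorted z] l) =
  S_sign R v *
  (partial_schur R (minor_partition (abelian_vector v) z) (letter_set v)).@[x] *
  \prod_(i < n) \det (\matrix_(a < #|letter_set v i|, b < #|letter_set v i|)
                        x (enum_val b) ^+ a).
Proof.
move=> zP; have [h [p [h1 hE p_lt h2]]] := minor_set_word zP.
set X := \matrix_(l, j) _.
have -> : \det X = (-1) ^+ p * \det (row_perm p X).
  by rewrite row_permE det_mulmx det_perm mulrA -expr2 sqrr_sign mul1r.
have -> : (-1) ^+ p = S_sign R v.
  (* Since [p] keeps equal letters in order, its inversions are exactly those of [v]. *)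
  rewrite sign_perm_inv /S_sign; congr (_ ^+ _); apply: eq_card => -[a b].
  rewrite !inE /= p_lt; case: ltnP => //= ab.
  by rewrite (ltnNge b a) (ltnW ab) andbF orbF.
rewrite -mulrA; congr (_ * _).
have XE a b : row_perm p X a b = (tnth v a == tnth v b)%:R * x b ^+ (h a).2.
  by rewrite !mxE hE h1.
rewrite (det_block_diag (c := tnth v)) => [|a b ab]; last first.
  by rewrite XE (negbTE ab) mul0r.
rewrite /partial_schur rmorph_prod -big_split; apply: eq_bigr => i _ /=.
rewrite schur_eval; congr (\det _); apply/matrixP => a b.
have vi (c : 'I_#|letter_set v i|) : tnth v (enum_val c) = i.
  by have := enum_valP c; rewrite inE => /eqP.
by rewrite mxE XE !vi eqxx mul1r h2 mxE.
Qed.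

(** A term of the Leibniz expansion without a vanishing indicator would match the keys of [z]
    bijectively with positions of the same letter, forcing [z] to have the letter counts of [v]. *)
Lemma det_not_minor_set (R : comPzRingType) n N nu (v : N.-tuple 'I_n)
    (z : {set 'I_n * 'I_nu}) (x : 'I_N -> R) :
  #|z| = N -> z \notin minor_sets nu (abelian_vector v) ->
  \det (\matrix_(l < N, j < N) nth 0
     [seq (t.1 == tnth v j)%:R * x j ^+ t.2 | t : 'I_n * 'I_nu <- lex_sorted z] l) = 0.
Proof.
move=> zN zP; have [u [u_inj u_surj uz uE]] :=
  nth_perm_enum zN (perm_lex_sorted z).
apply: big1 => s _; suff [l ul] : exists l, (u l).1 != tnth v (s l).
  by rewrite (bigD1 l) //= mxE uE (negbTE ul) !mul0r mulr0.
apply/existsP; apply: contraNT zP => /existsPn us.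
have {}us l : (u l).1 = tnth v (s l) by apply/eqP; have := us l; rewrite negbK.
rewrite inE; apply/forallP => i; apply/eqP.
have -> : [set sk in z | sk.1 == i] = u @: (s @^-1: letter_set v i).
  apply/setP => t; rewrite inE; apply/andP/imsetP => [[tz ti]|[l]].
    by have [l lt] := u_surj t tz; exists l; rewrite // !inE -us lt.
  by rewrite !inE -us => ? ->; rewrite uz.
rewrite card_imset // on_card_preimset //.
exact/onW_bij/(Bijective (permK s) (permKV s)).
Qed.

Lemma det_model_matrix (R : idomainType) n N nu (v : N.-tuple 'I_n)
    (P : param_tensor R N n nu) (x : 'I_N -> R) :
  \det (model_matrix v P x) =
  S_sign R v *
  (\sum_(z in minor_sets nu (abelian_vector v))
     \det (tensor_minor P z) *
     (partial_schur R (minor_partition (abelian_vector v) z)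
        (letter_set v)).@[x]) *
  \prod_(i < n) \det (\matrix_(a < #|letter_set v i|, b < #|letter_set v i|)
                        x (enum_val b) ^+ a).
Proof.
have -> : model_matrix v P x = \matrix_(i, j) \sum_(t : 'I_n * 'I_nu)
    P i t.1 t.2 * ((t.1 == tnth v j)%:R * x j ^+ t.2).
  apply/matrixP => i j; rewrite !mxE.
  (* Of the keys [(c, k)], only those with [c] the letter at position [j] survive the indicator. *)
  rewrite -(pair_bigA _ (fun c k => P i c k * ((c == tnth v j)%:R * x j ^+ k))).
  rewrite /= (bigD1 (tnth v j)) //= [X in _ + X]big1 ?addr0 => [|c /negbTE cv].
    by apply: eq_bigr => k _; rewrite eqxx mul1r.
  by rewrite big1 // => k _; rewrite cv mul0r mulr0.
rewrite (Cauchy_Binet _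
  (fun (t : 'I_n * 'I_nu) j => (t.1 == tnth v j)%:R * x j ^+ t.2)
  (@perm_lex_sorted n nu)).
rewrite (bigID (fun z => z \in minor_sets nu (abelian_vector v))) /=.
rewrite [X in _ + X]big1 ?addr0 => [|z /andP[/eqP zN zP]]; last first.
  by rewrite (det_not_minor_set _ zN zP) mulr0.
rewrite mulr_sumr mulr_suml; apply: eq_big => [z|z /andP[_ zP]].
  by apply: andb_idl => /card_minor_set ->.
by rewrite (det_minor_set _ zP) !mulrA (mulrC (\det _) (S_sign R v)).
Qed.

Lemma alternant_gt0 (R : realDomainType) d (y : 'I_d -> R) :
  {homo y : i j / (i < j)%N >-> i < j} ->
  0 < \det (\matrix_(i < d, j < d) y j ^+ i).
Proof.
move=> y_lt; have -> : \matrix_(i < d, j < d) y j ^+ i =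
    Vandermonde d (\row_j y j) by apply/matrixP => i j; rewrite !mxE.
rewrite det_Vandermonde; apply: prodr_gt0 => i _; apply: prodr_gt0 => j ij.
by rewrite !mxE subr_gt0 y_lt.
Qed.

Theorem corollary2 (R : realType) (W : finGroupType) (n : nat)
    (s : coxeterSystem W n) (irr_s : irreducible_coxeter s)
    (w0 : W) (longest_w0 : is_longest s w0)
    (P : param_tensor R (cox_length s w0) n (max_occ s w0))
    (v : (cox_length s w0).-tuple 'I_n) (v_red : v \in reduced_words s w0)
    (x : 'I_(cox_length s w0) -> R)
    (x_gt0 : forall i, 0 < x i)
    (x_incr : forall i j : 'I_(cox_length s w0),
      (i < j)%N -> tnth v i = tnth v j -> x i < x j) :
  Num.sg (\det (model_matrix v P x)) =
  S_sign R v *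
  Num.sg (\sum_(z in minor_sets (max_occ s w0) (abelian_vector v))
            \det (tensor_minor P z) *
            (partial_schur R (minor_partition (abelian_vector v) z)
               (letter_set v)).@[x]).
Proof.
have V_gt0 : 0 < \prod_(i < n)
    \det (\matrix_(a < #|letter_set v i|, b < #|letter_set v i|)
            x (enum_val b) ^+ a).
  apply: prodr_gt0 => i _; apply: alternant_gt0 => a b ab.
  have vi (c : 'I_#|letter_set v i|) : tnth v (enum_val c) = i.
    by have := enum_valP c; rewrite inE => /eqP.
  by apply: x_incr; rewrite ?vi // ltn_enum_val.
rewrite det_model_matrix sgrM sgrM (gtr0_sg V_gt0) mulr1.
congr (_ * _).
by rewrite /S_sign sgrX sgrN1.
Qed.
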